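(* For any natural number $x\in\mathbb{N}$, there exists at most one canonical representation of $x$ in the normalized Mersenne basis. That is, if $$x=\sum_{j=1}^{K} a_j M_j=\sum_{j=1}^{K'} a'_j M_j$$ are two canonical representations of $x$, and the shorter sum is padded with zero coefficients so that both have length $N=\max(K,K')$, then $a_j=a'_j$ for all $1\le j\le N$.
   Context: The normalized Mersenne basis is the sequence of rational numbers $M_k=\frac{2^k-1}{3}$, for integers $k\ge 1$ (so $M_1=1/3$, $M_2=1$, $M_3=7/3$, $M_4=5,\dots$). A canonical representation (canonical form) of a natural number $x$ is a representation $x=\sum_{k=1}^{K} a_k M_k$ with $a_k\in\{0,1,2\}$ satisfying the canonicity condition: for any index $k\le K$, $$\sum_{j=1}^{k-1} a_j M_j < M_k .$$
   Formalization: Adds the hypothesis that the zero-padded representations of length N = max(K,K') still satisfy the canonicity condition; without it the claim fails: 5 = M_1 + 2M_3 (K=3) and 5 = M_4 (K'=4) are both canonical but differ. *)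

(* Defs.v *)
From mathcomp Require Import all_boot all_order all_algebra.

Set Implicit Arguments.
Unset Strict Implicit.
Unset Printing Implicit Defensive.

Import Order.TTheory GRing.Theory Num.Theory.
Local Open Scope ring_scope.

Definition mersenne (k : nat) : rat := (2 ^+ k - 1) / 3.

(* A coefficient family is a function [a : nat -> nat] of which only the values
   [a 1, ..., a K] are meaningful for a representation of length [K]. *)
Definition mersenne_sum (K : nat) (a : nat -> nat) : rat :=
  \sum_(1 <= j < K.+1) (a j)%:R * mersenne j.

Definition canonicity (K : nat) (a : nat -> nat) : Prop :=
  forall k : nat, (1 <= k <= K)%N ->
    \sum_(1 <= j < k) (a j)%:R * mersenne j < mersenne k.

(* The empty representation [K = 0] of [x = 0] is allowed. *)
Definition canonical_representation (x K : nat) (a : nat -> nat) : Prop :=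
  [/\ forall k : nat, (1 <= k <= K)%N -> (a k <= 2)%N,
      x%:R = mersenne_sum K a
    & canonicity K a].

(* Padding a representation of length [K] with zero coefficients.
   Padding need not preserve canonicity: the condition at an index [k > K] says
   that the whole sum is less than [mersenne k].  For instance
   5 = M_1 + 2 M_3 is canonical at length 3, but since M_4 = 5 its padding to
   length 4 is not; and 5 = M_4 is canonical at length 4. *)
Definition zero_pad (K : nat) (a : nat -> nat) (j : nat) : nat :=
  if (j <= K)%N then a j else 0%N.

(* Main.v *)
(** The canonicity condition at the top index says that the lower-order part of
    a canonical sum is a remainder smaller than the top Mersenne number.  By
    uniqueness of Euclidean division, the value of the sum determines the top
    coefficient and the remainder, and one descends on the length. *)
Require Import Defs.
From mathcomp Require Import all_boot all_order all_algebra.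

Import Order.TTheory GRing.Theory Num.Theory.
Local Open Scope ring_scope.

Lemma mersenne_ge0 (k : nat) : 0 <= mersenne k.
Proof. by rewrite /mersenne divr_ge0 // subr_ge0 exprn_ege1. Qed.

Lemma mersenne_sum_ge0 (K : nat) (a : nat -> nat) : 0 <= mersenne_sum K a.
Proof. by apply: sumr_ge0 => j _; rewrite mulr_ge0 ?mersenne_ge0. Qed.

Lemma mersenne_sumS (K : nat) (a : nat -> nat) :
  mersenne_sum K.+1 a = mersenne_sum K a + (a K.+1)%:R * mersenne K.+1.
Proof. by rewrite /mersenne_sum big_nat_recr. Qed.

Lemma mersenne_sum_zero_pad (K N : nat) (a : nat -> nat) :
  (K <= N)%N -> mersenne_sum N (zero_pad K a) = mersenne_sum K a.
Proof.
move=> leKN; rewrite /mersenne_sum (@big_cat_nat _ _ _ K.+1) //=.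
rewrite [X in _ + X]big_nat_cond [X in _ + X]big1 ?addr0.
  by apply: eq_big_nat => j /andP[_]; rewrite ltnS /zero_pad => ->.
by move=> j /andP[/andP[ltKj _] _]; rewrite /zero_pad leqNgt ltKj mul0r.
Qed.

(** One half of the uniqueness of the Euclidean quotient: if [n < m], then
    [r + n d < (n + 1) d <= m d <= s + m d]. Exchanging the two sides gives the other half. *)
Lemma quotient_le (R : numDomainType) (d r s : R) (m n : nat) :
  0 <= d -> r < d -> 0 <= s -> r + n%:R * d = s + m%:R * d -> (m <= n)%N.
Proof.
move=> d_ge0 ltrd s_ge0 eq_rs; rewrite leqNgt; apply/negP => ltnm.
have : s + m%:R * d < n.+1%:R * d.
  by rewrite -eq_rs -natr1 mulrDl mul1r addrC ltrD2l.
apply/negP; rewrite le_gtF // -[leLHS]add0r lerD //.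
by rewrite ler_wpM2r // ler_nat.
Qed.

Lemma canonical_coef_unique (N : nat) (a b : nat -> nat) :
  canonicity N a -> canonicity N b -> mersenne_sum N a = mersenne_sum N b ->
  forall j : nat, (1 <= j <= N)%N -> a j = b j.
Proof.
elim: N => [|N IHN] can_a can_b eq_ab j; first by case: j.
have topN : (1 <= N.+1 <= N.+1)%N by rewrite leqnn.
(* The sum over [j < N.+1] in the canonicity condition at the top index is [mersenne_sum N a] by
   conversion. *)
have lt_a : mersenne_sum N a < mersenne N.+1 := can_a _ topN.
have lt_b : mersenne_sum N b < mersenne N.+1 := can_b _ topN.
rewrite !mersenne_sumS in eq_ab.
have eq_top : a N.+1 = b N.+1.
  apply/eqP; rewrite eqn_leq; apply/andP; split.
    exact: (quotient_le _ _ _ _ _ _ (mersenne_ge0 _) lt_b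
              (mersenne_sum_ge0 _ _) (esym eq_ab)).
  exact: (quotient_le _ _ _ _ _ _ (mersenne_ge0 _) lt_a
            (mersenne_sum_ge0 _ _) eq_ab).
case/andP=> j_gt0; rewrite leq_eqVlt => /predU1P[-> // | ltjN].
apply: IHN; last by rewrite j_gt0.
(* Canonicity passes to shorter lengths, and cancelling the equal top terms leaves equal
   remainders. *)
- by move=> k /andP[k_gt0 lekN]; apply: can_a; rewrite k_gt0 leqW.
- by move=> k /andP[k_gt0 lekN]; apply: can_b; rewrite k_gt0 leqW.
- by move: eq_ab; rewrite eq_top => /addIr.
Qed.

(** Canonicity is asked at the common length: this rules out the pair [5 = M_1 + 2 M_3] and
    [5 = M_4]. Padding keeps the value [x], so the equal-length case applies. *)
Theorem theorem4p2 (x K K' : nat) (a a' : nat -> nat)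
    (ha : canonical_representation x K a)
    (ha' : canonical_representation x K' a')
    (hpad : canonicity (maxn K K') (zero_pad K a))
    (hpad' : canonicity (maxn K K') (zero_pad K' a')) :
  forall j : nat, (1 <= j <= maxn K K')%N -> zero_pad K a j = zero_pad K' a' j.
Proof.
case: ha ha' => [_ sum_a _] [_ sum_a' _].
apply: canonical_coef_unique => //.
by rewrite !mersenne_sum_zero_pad ?leq_maxl ?leq_maxr // -sum_a -sum_a'.
Qed.
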